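(* Let $\mathbf{A}\in\mathbb{R}^{m\times n}$ be a nonzero, not necessarily full-rank matrix, and let $\mathbf{b}\in\mathbb{R}^m$ lie in the range (column space) of $\mathbf{A}$. Let $T = \{\tau_1, \dots, \tau_d\}$ be a $(d,\alpha,\beta,r,R)$ row covering of $\mathbf{A}$ with $\alpha>0$. Consider running the block Kaczmarz method with matrix $\mathbf{A}$ and vector $\mathbf{b}_k=\mathbf{b}+\mathbf{e}_k$ in the $k$th iteration, started from $\mathbf{x}_0\in\mathbb{R}^n$; that is, $$\mathbf{x}_k = \mathbf{x}_{k-1} + \mathbf{A}_{\tau}^\dagger\left((\mathbf{b}_k)_\tau - \mathbf{A}_\tau\mathbf{x}_{k-1}\right),$$ where at each iteration $\tau$ is chosen uniformly at random from $T$, independently of previous choices. Assume that the $\mathbf{e}_k$ are sampled i.i.d. according to a distribution $\mathscr{D}$ on $\mathbb{R}^m$, independently of the block choices, with $\mathbb{E}_{\mathscr{D}}[\mathbf{e}_k]=\mathbf{0}$ and $\operatorname{cov}(\mathbf{e}_k)=\mathbb{E}_{\mathscr{D}}[\mathbf{e}_k\mathbf{e}_k^\top]=\mathbf{\Sigma}$. Let $\mathbf{x}^* = (\mathbf{I}-\mathbf{A}^\dagger\mathbf{A})\mathbf{x}_0+\mathbf{A}^\dagger\mathbf{b}$. Then for all $j\ge0$, $$\mathbb{E}\|\mathbf{x}_{j+1}-\mathbf{x}^*\|^2 \le \left(1-\frac{r\,\sigma_{\min+}^2(\mathbf{A})}{\beta d}\right)^{j+1}\|\mathbf{x}_0-\mathbf{x}^*\|^2+\frac{\beta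 R}{\alpha\, r\,\sigma_{\min+}^2(\mathbf{A})}\operatorname{tr}(\mathbf{\Sigma}).$$
   Context: $\|\cdot\|$ is the Euclidean norm, $[m]=\{1,\dots,m\}$, $\mathbf{A}^\dagger$ is the Moore–Penrose pseudoinverse, $\sigma_{\min+}(\mathbf{A})$ is the smallest nonzero singular value of $\mathbf{A}$, and $\mathbf{A}_\tau$, $\mathbf{v}_\tau$ denote the restriction of a matrix or vector to the rows (entries) indexed by $\tau\subset[m]$. The expectation is over both the block choices and the errors. Row covering: a $(d,\alpha,\beta,r,R)$ row covering of $\mathbf{A}$ is a collection $T=\{\tau_1,\dots,\tau_d\}$ of subsets of $[m]$ such that every $i\in[m]$ lies in some $\tau_l$, and $\alpha \le \lambda_{\min+}(\mathbf{A}_\tau\mathbf{A}_\tau^\top)$ and $\lambda_{\max}(\mathbf{A}_\tau\mathbf{A}_\tau^\top)\le\beta$ for each $\tau\in T$, where $\lambda_{\min+}$ and $\lambda_{\max}$ denote the smallest nonzero and the largest eigenvalue, and $r=\min_{i\in[m]}|\{\tau_l\in T: i\in\tau_l\}|$, $R=\max_{i\in[m]}|\{\tau_l\in T: i\in\tau_l\}|$. *)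

(* Defs.v *)
From HB Require Import structures.
From mathcomp Require Import all_boot all_order all_algebra.
From mathcomp Require Import all_classical all_reals all_analysis.

Set Implicit Arguments.
Unset Strict Implicit.
Unset Printing Implicit Defensive.

Import Order.TTheory GRing.Theory Num.Theory.
Import numFieldNormedType.Exports.

Local Open Scope classical_set_scope.
Local Open Scope ring_scope.

Section LinearAlgebra.
Context {R : realType}.

(* The library norm on matrices is the sup norm, hence this definition. *)
Definition norm2 {n} (v : 'cV[R]_n) : R := Num.sqrt (\sum_i v i 0 ^+ 2).

Definition penrose {m n} (A : 'M[R]_(m, n)) (B : 'M[R]_(n, m)) : Prop :=
  [/\ A *m B *m A = A, B *m A *m B = B,
      (A *m B)^T = A *m B & (B *m A)^T = B *m A].

(* The default 0 is never used: exactly one matrix satisfies the Penrose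
   equations. *)
Definition mp_inverse {m n} (A : 'M[R]_(m, n)) : 'M[R]_(n, m) :=
  xget 0 [set B | penrose A B].

Definition singular_value {m n} (A : 'M[R]_(m, n)) (s : R) : Prop :=
  0 <= s /\ eigenvalue (A^T *m A) (s ^+ 2).

(* The smallest nonzero singular value when [A != 0]: the infimum is then over
   a nonempty finite set. *)
Definition sigma_minp {m n} (A : 'M[R]_(m, n)) : R :=
  inf [set s | singular_value A s /\ s != 0].

(* The two extremal eigenvalues of a symmetric matrix. They are extended reals
   so that a block without nonzero eigenvalue (resp. an empty block) gets +oo
   (resp. -oo), and thus puts no constraint on alpha (resp. beta) in
   [row_covering]. *)
Definition lambda_minp {k} (M : 'M[R]_k) : \bar R :=
  ereal_inf [set l%:E | l in [set l | eigenvalue M l /\ l != 0]].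

Definition lambda_max {k} (M : 'M[R]_k) : \bar R :=
  ereal_sup [set l%:E | l in [set l | eigenvalue M l]].

(* Rows are taken in the order of [enum tau]. *)
Definition row_restrict {m n} (tau : {set 'I_m}) (A : 'M[R]_(m, n)) :
  'M[R]_(#|tau|, n) := rowsub (fun i => enum_val i) A.

End LinearAlgebra.

Definition multiplicity {m d} (T : 'I_d -> {set 'I_m}) (i : 'I_m) : nat :=
  #|[set l | i \in T l]|.

(* All multiplicities are at most [d], so the default value [d] of the minimum
   is harmless as soon as [0 < m]. *)
Definition row_covering {R : realType} {m n d} (A : 'M[R]_(m, n))
    (T : 'I_d -> {set 'I_m}) (alpha beta : R) (r rmax : nat) : Prop :=
  [/\ forall i, exists l, i \in T l,
      forall l, (alpha%:E <= lambda_minp (row_restrict (T l) A *m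
                                          (row_restrict (T l) A)^T))%E,
      forall l, (lambda_max (row_restrict (T l) A *m
                             (row_restrict (T l) A)^T) <= beta%:E)%E,
      r = \big[minn/d]_(i < m) multiplicity T i &
      rmax = (\max_(i < m) multiplicity T i)%N].

(* Sequences are 0-based: [tau k] and [b k] are the block and the right-hand
   side used to go from the iterate k to the iterate k + 1. *)
Fixpoint block_kaczmarz {R : realType} {m n} (A : 'M[R]_(m, n))
    (x0 : 'cV[R]_n) (tau : nat -> {set 'I_m}) (b : nat -> 'cV[R]_m)
    (k : nat) : 'cV[R]_n :=
  match k with
  | 0 => x0
  | j.+1 =>
    let x := block_kaczmarz A x0 tau b j in
    x + mp_inverse (row_restrict (tau j) A) *m
        (row_restrict (tau j) (b j) - row_restrict (tau j) A *m x)
  end.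

(* R^m with its Borel sigma-algebra. *)
Notation borel_cV R m := (g_sigma_algebraType (@open 'cV[R]_m)).

Definition independent_systems {disp : measure_display}
    {Omega : measurableType disp} {R : realType} (P : probability Omega R)
    {I : eqType} (F : I -> set (set Omega)) : Prop :=
  forall (J : seq I) (E : I -> set Omega), uniq J ->
    (forall j, j \in J -> F j (E j)) ->
    P (\bigcap_(j in [set` J]) E j) = (\prod_(j <- J) P (E j))%E.

(* The generated sigma-algebras of all the random variables together: [inl k]
   for the k-th choice of an index in 'I_d (a discrete space), [inr k] for the
   k-th error. *)
Definition choice_error_sigma {disp : measure_display}
    {Omega : measurableType disp} {R : realType} {m d : nat}
    (c : nat -> Omega -> 'I_d) (e : nat -> Omega -> borel_cV R m)
    (i : nat + nat) : set (set Omega) :=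
  match i with
  | inl k => preimage_set_system setT (c k) setT
  | inr k => preimage_set_system setT (e k) measurable
  end.

(* Main.v *)
Require Import Defs.
From HB Require Import structures.
From mathcomp Require Import all_boot all_order all_algebra.
From mathcomp Require Import all_classical all_reals all_analysis.
From mathcomp Require Import measurable_realfun.
From mathcomp Require Import ring lra.

Set Implicit Arguments.
Unset Strict Implicit.
Unset Printing Implicit Defensive.

Import Order.TTheory GRing.Theory Num.Theory.
Import numFieldNormedType.Exports.

Local Open Scope classical_set_scope.
Local Open Scope ring_scope.

(** The point xstar satisfies A xstar = b, so with B = A_tau and P the
orthogonal projection B^+ B onto the row space of B, one step reads
  x_{k+1} - xstar = (I - P) (x_k - xstar) + B^+ (e_k)_tau.
The two terms are orthogonal (one lies in the kernel of B, the other in its row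
space), so Pythagoras gives the squared error exactly, without cross term
([sqnorm_kaczmarz_step]).

- First term. The error always lies in the row space of A
  ([row_proj_error]). For such a y, |B y|^2 <= beta |P y|^2 for each block, the
  sum of |A_tau y|^2 over the blocks counts each row of A at least r times, and
  |A y|^2 >= sigma^2 |y|^2. Hence averaging |(I - P) y|^2 over the d blocks
  multiplies |y|^2 by at most 1 - r sigma^2 / (beta d)
  ([sum_residual_le]).
- Second term. |B^+ w|^2 <= |w|^2 / alpha, and each row is counted at most rmax
  times, so the average over the blocks is at most rmax / (alpha d) |e_k|^2
  ([sum_noise_le]), whose mean is rmax / (alpha d) tr Sigma.

The k-th block is independent of the pair (x_k, e_k), hence the mean squared error
V_k satisfies V_{k+1} <= rate V_k + rmax / (alpha d) tr Sigma
([mean_step]); the last term of the bound is the fixed point of this affine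
recursion, so that V_k <= rate^k V_0 + fixed point by induction
([mean_error_le]).

Two facts carry the rest. The eigenvalue hypotheses become inequalities between
quadratic forms through [rayleigh_min]: on an invariant subspace, a quadratic
form attains its minimum over the unit sphere at an eigenvector.
Independence becomes a factorization of integrals through
[integral_indep_event], applied to the sigma-algebra generated by all the
choices and errors other than the k-th choice, for which both x_k and e_k are
measurable. *)

(** * Euclidean inner product of columns *)

Section LinearAlgebra.
Variable R : realType.

Definition dotc n (u v : 'cV[R]_n) : R := (u^T *m v) 0 0.

Lemma dotcE n (u v : 'cV[R]_n) : dotc u v = \sum_i u i 0 * v i 0.
Proof. by rewrite /dotc mxE; apply: eq_bigr => i _; rewrite mxE. Qed.

Lemma dotcC n (u v : 'cV[R]_n) : dotc u v = dotc v u.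
Proof. by rewrite !dotcE; apply: eq_bigr => i _; rewrite mulrC. Qed.

Lemma dotcDl n (u v w : 'cV[R]_n) : dotc (u + v) w = dotc u w + dotc v w.
Proof. by rewrite /dotc linearD /= mulmxDl mxE. Qed.

Lemma dotcDr n (u v w : 'cV[R]_n) : dotc u (v + w) = dotc u v + dotc u w.
Proof. by rewrite /dotc mulmxDr mxE. Qed.

Lemma dotcZl n a (u v : 'cV[R]_n) : dotc (a *: u) v = a * dotc u v.
Proof. by rewrite /dotc linearZ /= -scalemxAl mxE. Qed.

Lemma dotcZr n a (u v : 'cV[R]_n) : dotc u (a *: v) = a * dotc u v.
Proof. by rewrite dotcC dotcZl dotcC. Qed.

Lemma dotc0r n (u : 'cV[R]_n) : dotc u 0 = 0.
Proof. by rewrite /dotc mulmx0 mxE. Qed.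

Lemma dotc_trmx k n (M : 'M[R]_(k, n)) u v :
  dotc (M *m u) v = dotc u (M^T *m v).
Proof. by rewrite /dotc trmx_mul mulmxA. Qed.

Definition sqnorm n (v : 'cV[R]_n) : R := dotc v v.

Lemma sqnormE n (v : 'cV[R]_n) : sqnorm v = \sum_i v i 0 ^+ 2.
Proof. by rewrite /sqnorm dotcE. Qed.

Lemma sqnorm_ge0 n (v : 'cV[R]_n) : 0 <= sqnorm v.
Proof. by rewrite sqnormE; apply: sumr_ge0 => i _; rewrite sqr_ge0. Qed.

Lemma norm2_sqr n (v : 'cV[R]_n) : norm2 v ^+ 2 = sqnorm v.
Proof. by rewrite /norm2 -sqnormE sqr_sqrtr ?sqnorm_ge0. Qed.

Lemma sqnorm_eq0 n (v : 'cV[R]_n) : (sqnorm v == 0) = (v == 0).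
Proof.
apply/eqP/eqP => [|->]; last by rewrite /sqnorm dotc0r.
rewrite sqnormE => /eqP.
rewrite psumr_eq0 => [/allP v0|i _]; last exact: sqr_ge0.
apply/matrixP => i j; rewrite (ord1 j) mxE; apply/eqP.
by have := v0 i (mem_index_enum i); rewrite sqrf_eq0.
Qed.

Lemma sqnorm_gt0 n (v : 'cV[R]_n) : (0 < sqnorm v) = (v != 0).
Proof. by rewrite lt_def sqnorm_ge0 andbT sqnorm_eq0. Qed.

Lemma sqnorm0 n : sqnorm (0 : 'cV[R]_n) = 0.
Proof. by rewrite /sqnorm dotc0r. Qed.

Lemma sqnormD n (u v : 'cV[R]_n) :
  sqnorm (u + v) = sqnorm u + 2 * dotc u v + sqnorm v.
Proof. by rewrite /sqnorm dotcDl !dotcDr (dotcC v u); ring. Qed.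

Lemma sqnormZ n a (v : 'cV[R]_n) : sqnorm (a *: v) = a ^+ 2 * sqnorm v.
Proof. by rewrite /sqnorm dotcZl dotcZr; ring. Qed.

Lemma coord_sqr_le_sqnorm n (v : 'cV[R]_n) i : v i 0 ^+ 2 <= sqnorm v.
Proof.
by rewrite sqnormE (bigD1 i) //= lerDl; apply: sumr_ge0 => j _; rewrite sqr_ge0.
Qed.

(** * Minima of quadratic forms *)

Lemma sum_continuous (T : topologicalType) (I : Type) (r : seq I)
    (F : I -> T -> R) :
  (forall i, continuous (F i)) -> continuous (fun x => \sum_(i <- r) F i x).
Proof.
move=> Fc; apply: (@continuous_big R I +%R 0 xpredT) => [|i _]; last exact: Fc.
by move=> z; apply: cvgD; [exact: cvg_fst | exact: cvg_snd].
Qed.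

Lemma coord_mx_continuous k n (M : 'M[R]_(n, k)) i :
  continuous (fun v : 'rV[R]_k => (M *m v^T) i 0).
Proof.
have -> : (fun v : 'rV[R]_k => (M *m v^T) i 0) =
    (fun v => \sum_j M i j * v 0 j).
  by apply/funext => v; rewrite mxE; apply: eq_bigr => j _; rewrite mxE.
apply: (@sum_continuous 'rV[R]_k) => j.
move=> v; apply: (@cvgM R 'rV[R]_k (nbhs v) _ (fun=> M i j)).
  exact: cvg_cst.
exact: coord_continuous.
Qed.

Lemma dotc_mx_continuous k n (M N : 'M[R]_(n, k)) :
  continuous (fun v : 'rV[R]_k => dotc (M *m v^T) (N *m v^T)).
Proof.
have -> : (fun v : 'rV[R]_k => dotc (M *m v^T) (N *m v^T)) =
    (fun v => \sum_i (M *m v^T) i 0 * (N *m v^T) i 0).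
  by apply/funext => v; rewrite dotcE.
apply: (@sum_continuous 'rV[R]_k) => i.
by move=> v; apply: (@cvgM R 'rV[R]_k (nbhs v)); exact: coord_mx_continuous.
Qed.

(** The subspace is the image of the matrix [P], and commutation with [M] makes
it invariant. Compactness gives a unit vector u of the subspace at which the
form is minimal, with value mu. Then N = M - mu is nonnegative on the subspace
and vanishes at u; since w = N u stays in the subspace, the value of N at
u - t w, which is - 2 t |w|^2 + O(t^2), can only be nonnegative for all t > 0
if w = 0. *)
Lemma rayleigh_min n (M P : 'M[R]_n) (u0 : 'cV[R]_n) :
  M^T = M -> P *m M = M *m P -> P *m u0 = u0 -> u0 != 0 ->
  exists mu, exists2 u : 'cV[R]_n, [/\ u != 0, P *m u = u & M *m u = mu *: u] &
    forall v, P *m v = v -> mu * sqnorm v <= dotc v (M *m v).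
Proof.
move=> Msym PM Pu0 u0n0.
pose K := [set v : 'rV[R]_n | sqnorm ((1%:M - P) *m v^T) = 0 /\ sqnorm v^T = 1].
have KE v : K v <-> P *m v^T = v^T /\ sqnorm v^T = 1.
  rewrite /K /=; split=> -[h1 ->]; split=> //.
    move/eqP: h1; rewrite sqnorm_eq0 mulmxBl mul1mx subr_eq0 => /eqP h1.
    by rewrite -h1.
  by apply/eqP; rewrite sqnorm_eq0 mulmxBl mul1mx h1 subrr.
have Kc : compact K.
  apply: bounded_closed_compact.
    exists 1; split; first exact: num_real.
    move=> x x1 v /KE[_ v1]; apply: le_trans (ltW x1).
    rewrite /Num.norm /= mx_normE.
    have -> : 1 = (1%:nng : {nonneg R})%:num by [].
    rewrite num_le; apply/bigmax_leP; split => [|[i j] _ /=].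
      by rewrite -num_le.
    rewrite -num_le /= (ord1 i) -(@ler_pXn2r _ 2) ?nnegrE//.
    rewrite expr1n real_normK ?num_real// -v1.
    by have := coord_sqr_le_sqnorm v^T j; rewrite mxE.
  have -> : K = (fun v : 'rV[R]_n => sqnorm ((1%:M - P) *m v^T)) @^-1` [set 0]
      `&` (fun v : 'rV[R]_n => sqnorm (1%:M *m v^T)) @^-1` [set 1].
    by apply/seteqP; split => v /=; rewrite mul1mx.
  apply: closedI; apply: preimage_closed; try exact: closed_eq;
    by move=> v _; exact: dotc_mx_continuous.
pose s := (Num.sqrt (sqnorm u0))^-1.
have K0 : K !=set0.
  exists (s *: u0)^T; apply/KE; rewrite trmxK -scalemxAr Pu0; split => //.
  by rewrite sqnormZ /s exprVn sqr_sqrtr ?sqnorm_ge0// mulVf// sqnorm_eq0.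
have [|u'] := @EVT_min_rV R n (fun v => dotc (1%:M *m v^T) (M *m v^T)) K K0 Kc.
  by apply: continuous_subspaceT => v; exact: dotc_mx_continuous.
rewrite inE => /KE; set u := u'^T => -[Pu u1] umin.
set mu := dotc _ _ in umin.
have muE : mu = dotc u (M *m u) by rewrite /mu mul1mx.
have min v : P *m v = v -> mu * sqnorm v <= dotc v (M *m v).
  move=> Pv; have [->|vn0] := eqVneq v 0.
    by rewrite sqnorm0 mulmx0 dotc0r mulr0.
  pose t := (Num.sqrt (sqnorm v))^-1.
  have t2 : t ^+ 2 = (sqnorm v)^-1 by rewrite /t exprVn sqr_sqrtr ?sqnorm_ge0.
  have := umin (t *: v)^T; rewrite trmxK mul1mx -scalemxAr dotcZl dotcZr mulrA.
  rewrite -expr2 t2 => h; rewrite -ler_pdivlMr ?sqnorm_gt0// mulrC; apply: h.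
  rewrite inE; apply/KE; rewrite trmxK -scalemxAr Pv; split => //.
  by rewrite sqnormZ t2 mulVf// sqnorm_eq0.
exists mu, u => //; split => //.
  by rewrite -sqnorm_eq0 u1 oner_eq0.
pose w := M *m u - mu *: u.
have Pw : P *m w = w by rewrite /w mulmxBr mulmxA PM -mulmxA -scalemxAr Pu.
suff: w = 0 by move/eqP; rewrite subr_eq0 => /eqP.
apply/eqP; rewrite -sqnorm_eq0 eq_le sqnorm_ge0 andbT leNgt; apply/negP => a0.
pose q := dotc w (M *m w) - mu * sqnorm w.
have q0 : 0 <= q by rewrite subr_ge0 min.
have wN : dotc w (M *m u) - mu * dotc w u = sqnorm w.
  by rewrite -mulNr -dotcZr -dotcDr scaleNr.
(* A step size below |w|^2 / q, so that the linear term wins; the + 1 covers the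
   case q = 0. *)
pose t := sqnorm w / (q + 1).
have t0 : 0 < t by rewrite divr_gt0// ltr_wpDl.
have := min (u + (- t) *: w); rewrite mulmxDr -scalemxAr Pu Pw => /(_ erefl).
rewrite sqnormD sqnormZ u1 mulmxDr -scalemxAr !dotcDl !dotcDr !dotcZr !dotcZl.
have -> : dotc u (M *m w) = dotc w (M *m u).
  by rewrite [RHS]dotcC dotc_trmx Msym.
rewrite -muE (dotcC u w) => h.
have {h} : t * (2 * sqnorm w) <= t * (t * q).
  move: h; rewrite /q -wN; clear; lra.
have tq : t * (q + 1) = sqnorm w by rewrite /t divfK// lt0r_neq0// ltr_wpDl.
move: tq; rewrite mulrDr mulr1 => tq; rewrite ler_pM2l// => h.
have : 2 * sqnorm w <= sqnorm w - t by by rewrite -{2}tq addrK.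
move: a0 t0; clear; lra.
Qed.

(** * Moore-Penrose inverse and projection onto the row space *)

Lemma gram_unit k n (F : 'M[R]_(k, n)) : row_free F -> F *m F^T \in unitmx.
Proof.
move=> Ffree; rewrite -row_free_unit; apply: inj_row_free => v vFF.
apply/eqP; rewrite -(mulmx_free_eq0 v Ffree) -trmx_eq0 -sqnorm_eq0.
by rewrite /sqnorm /dotc trmxK trmx_mul mulmxA -(mulmxA v) vFF mul0mx mxE.
Qed.

(** The inverse of C F is F^T (F F^T)^-1 (C^T C)^-1 C^T: both Gram matrices are
invertible because the factors have full rank. *)
Lemma penrose_rank_factorization k m n (C : 'M[R]_(m, k)) (F : 'M[R]_(k, n)) :
  row_full C -> row_free F -> exists B, penrose (C *m F) B.
Proof.
move=> Cfull Ffree.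
have Gu : F *m F^T \in unitmx by exact: gram_unit.
have Hu : C^T *m C \in unitmx.
  by rewrite -{2}[C]trmxK; apply: gram_unit; rewrite /row_free mxrank_tr.
set G := F *m F^T in Gu; set H := C^T *m C in Hu.
have Gs : (invmx G)^T = invmx G by rewrite trmx_inv /G trmx_mul trmxK.
have Hs : (invmx H)^T = invmx H by rewrite trmx_inv /H trmx_mul trmxK.
pose B := F^T *m invmx G *m (invmx H *m C^T).
have ABE : C *m F *m B = C *m (invmx H *m C^T).
  by rewrite /B -!mulmxA (mulmxA F) (mulmxA (F *m F^T)) mulmxV// mul1mx.
have BAE : B *m (C *m F) = F^T *m invmx G *m F.
  rewrite /B -!mulmxA; congr (_ *m (_ *m _)).
  by rewrite (mulmxA C^T) mulmxA mulVmx// mul1mx.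
exists B; split.
- rewrite ABE -!mulmxA; congr (_ *m _).
  by rewrite (mulmxA C^T) mulmxA mulVmx// mul1mx.
- rewrite BAE /B -!mulmxA; congr (_ *m (_ *m _)).
  by rewrite (mulmxA F) mulmxA mulmxV// mul1mx.
- by rewrite ABE !trmx_mul trmxK Hs mulmxA.
- by rewrite BAE !trmx_mul trmxK Gs mulmxA.
Qed.

Lemma penrose_ex m n (A : 'M[R]_(m, n)) : exists B, penrose A B.
Proof.
rewrite -(mulmx_base A); apply: penrose_rank_factorization.
  exact: col_base_full.
exact: row_base_free.
Qed.

Lemma mp_inverseP m n (A : 'M[R]_(m, n)) : penrose A (mp_inverse A).
Proof. exact: (xgetPex 0 (penrose_ex A)). Qed.

Definition row_proj m n (A : 'M[R]_(m, n)) : 'M[R]_n := mp_inverse A *m A.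

Lemma row_projT m n (A : 'M[R]_(m, n)) : (row_proj A)^T = row_proj A.
Proof. by have [] := mp_inverseP A. Qed.

Lemma mulmx_row_proj m n (A : 'M[R]_(m, n)) : A *m row_proj A = A.
Proof. by rewrite mulmxA; have [] := mp_inverseP A. Qed.

Lemma row_proj_mp m n (A : 'M[R]_(m, n)) :
  row_proj A *m mp_inverse A = mp_inverse A.
Proof. by have [] := mp_inverseP A. Qed.

Lemma row_proj_idem m n (A : 'M[R]_(m, n)) :
  row_proj A *m row_proj A = row_proj A.
Proof. by rewrite {2}/row_proj mulmxA row_proj_mp. Qed.

Lemma row_proj_tr m n (A : 'M[R]_(m, n)) : row_proj A *m A^T = A^T.
Proof. by rewrite -[row_proj A]row_projT -trmx_mul mulmx_row_proj. Qed.

Lemma sqnorm_proj n (Q : 'M[R]_n) (w : 'cV[R]_n) :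
  Q^T = Q -> Q *m Q = Q ->
  sqnorm w = sqnorm (Q *m w) + sqnorm ((1%:M - Q) *m w).
Proof.
move=> Qs QQ; have {1}-> : w = Q *m w + (1%:M - Q) *m w.
  by rewrite -mulmxDl addrC subrK mul1mx.
rewrite sqnormD dotc_trmx Qs mulmxA mulmxBr mulmx1 QQ subrr mul0mx.
by rewrite dotc0r mulr0 addr0.
Qed.

Lemma sqnorm_proj_le n (Q : 'M[R]_n) (w : 'cV[R]_n) :
  Q^T = Q -> Q *m Q = Q -> sqnorm (Q *m w) <= sqnorm w.
Proof. by move=> Qs QQ; rewrite (sqnorm_proj w Qs QQ) lerDl sqnorm_ge0. Qed.

(** * Extremal eigenvalues of Gram matrices *)

Lemma eigenvalue_col n (M : 'M[R]_n) mu (u : 'cV[R]_n) :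
  M^T = M -> u != 0 -> M *m u = mu *: u -> eigenvalue M mu.
Proof.
move=> Ms u0 Mu; apply/eigenvalueP; exists u^T; last by rewrite trmx_eq0.
by rewrite -{1}Ms -trmx_mul Mu linearZ.
Qed.

Lemma gram_sqnorm k n (B : 'M[R]_(k, n)) (v : 'cV[R]_n) :
  dotc v (B^T *m B *m v) = sqnorm (B *m v).
Proof. by rewrite /sqnorm dotc_trmx mulmxA. Qed.

Section Gram.
Variables (k n : nat) (B : 'M[R]_(k, n)).
Hypothesis B0 : B != 0.

Lemma row_proj_ex : exists2 u : 'cV[R]_n, row_proj B *m u = u & u != 0.
Proof.
have [j Pj] : exists j, col j (row_proj B) != 0.
  apply/existsP; apply: contraNT B0; rewrite negb_exists => /forallP P0.
  rewrite -(mulmx_row_proj B) (_ : row_proj B = 0) ?mulmx0//.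
  apply/matrixP => i j; have /negPn/eqP/matrixP/(_ i 0) := P0 j.
  by rewrite !mxE.
by exists (col j (row_proj B)); rewrite // colE mulmxA row_proj_idem.
Qed.

Let gramT : (B^T *m B)^T = B^T *m B.
Proof. by rewrite trmx_mul trmxK. Qed.

Let gram_projC : row_proj B *m (B^T *m B) = B^T *m B *m row_proj B.
Proof. by rewrite mulmxA row_proj_tr -mulmxA mulmx_row_proj. Qed.

Let gram_eig_gt0 mu (u : 'cV[R]_n) : u != 0 -> row_proj B *m u = u ->
  B^T *m B *m u = mu *: u -> 0 < mu.
Proof.
move=> u0 Pu Mu; rewrite -(@pmulr_lgt0 _ (sqnorm u)) ?sqnorm_gt0//.
rewrite -dotcZr -Mu gram_sqnorm sqnorm_gt0; apply: contra u0 => /eqP Bu.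
by rewrite -Pu /row_proj -mulmxA Bu mulmx0.
Qed.

(** The minimum is taken over the row space of [B], where [B] is injective: this
is what makes the minimal eigenvalue nonzero. *)
Lemma gram_min : exists mu, [/\ 0 < mu, eigenvalue (B^T *m B) mu &
  forall v, row_proj B *m v = v -> mu * sqnorm v <= sqnorm (B *m v)].
Proof.
have [u0 Pu0 u00] := row_proj_ex.
have [mu [u [un0 Pu Mu] min]] := rayleigh_min gramT gram_projC Pu0 u00.
exists mu; split; first exact: gram_eig_gt0 Mu.
  exact: eigenvalue_col Mu.
by move=> v /min; rewrite gram_sqnorm.
Qed.

(** The previous argument for [- B^T B]. Restricting to the row space loses
nothing for the maximum, and again gives a nonzero eigenvalue, as needed to move
to [B B^T]. *)
Lemma gram_max : exists nu, [/\ 0 < nu, eigenvalue (B^T *m B) nu &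
  forall v, row_proj B *m v = v -> sqnorm (B *m v) <= nu * sqnorm v].
Proof.
have [u0 Pu0 u00] := row_proj_ex.
have NT : (- (B^T *m B))^T = - (B^T *m B) by rewrite linearN /= gramT.
have NP : row_proj B *m - (B^T *m B) = - (B^T *m B) *m row_proj B.
  by rewrite mulmxN mulNmx gram_projC.
have [mu [u [un0 Pu Mu] min]] := rayleigh_min NT NP Pu0 u00.
have Mu' : B^T *m B *m u = (- mu) *: u by rewrite scaleNr -Mu mulNmx opprK.
exists (- mu); split; first exact: gram_eig_gt0 Mu'.
  exact: eigenvalue_col Mu'.
move=> v /min; rewrite mulNmx -scaleN1r dotcZr gram_sqnorm mulN1r mulNr.
by rewrite lerNr.
Qed.

End Gram.

Lemma eigenvalue_mulC k n (B : 'M[R]_(k, n)) mu :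
  mu != 0 -> eigenvalue (B^T *m B) mu -> eigenvalue (B *m B^T) mu.
Proof.
move=> mu0 /eigenvalueP[v vE v0]; apply/eigenvalueP; exists (v *m B^T).
  by rewrite mulmxA -(mulmxA v) vE scalemxAl.
apply: contra v0 => /eqP vB.
have := vE; rewrite mulmxA vB mul0mx => /esym/eqP.
by rewrite scaler_eq0 (negPf mu0).
Qed.

Lemma row_proj0 k n (v : 'cV[R]_n) : row_proj (0 : 'M[R]_(k, n)) *m v = 0.
Proof. by rewrite /row_proj mulmx0 mul0mx. Qed.

(** [lambda_minp] and [lambda_max] are about [B B^T], while errors live in the
space on which [B^T B] acts; the two share their nonzero eigenvalues. *)
Lemma lambda_minp_le k n (B : 'M[R]_(k, n)) alpha v :
  (alpha%:E <= lambda_minp (B *m B^T))%E -> row_proj B *m v = v ->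
  alpha * sqnorm v <= sqnorm (B *m v).
Proof.
move=> aB Pv; have [B0|B0] := eqVneq B 0.
  by rewrite -Pv B0 row_proj0 mulmx0 !sqnorm0 mulr0.
have [mu [mu0 mue min]] := gram_min B0.
apply: le_trans (min v Pv); rewrite ler_wpM2r ?sqnorm_ge0// -lee_fin.
apply: le_trans aB _; apply: ereal_inf_lbound; exists mu => //=; split.
  by apply: eigenvalue_mulC => //; rewrite gt_eqF.
by rewrite gt_eqF.
Qed.

Lemma lambda_max_eig k n (B : 'M[R]_(k, n)) beta nu : 0 < nu ->
  (lambda_max (B *m B^T) <= beta%:E)%E -> eigenvalue (B^T *m B) nu ->
  nu <= beta.
Proof.
move=> nu0 bB nue; rewrite -lee_fin; apply: le_trans bB.
apply: ereal_sup_ubound; exists nu => //=.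
by apply: eigenvalue_mulC => //; rewrite gt_eqF.
Qed.

Lemma lambda_max_ge k n (B : 'M[R]_(k, n)) beta v :
  (lambda_max (B *m B^T) <= beta%:E)%E -> row_proj B *m v = v ->
  sqnorm (B *m v) <= beta * sqnorm v.
Proof.
move=> bB Pv; have [B0|B0] := eqVneq B 0.
  by rewrite -Pv B0 row_proj0 mulmx0 !sqnorm0 mulr0.
have [nu [nu0 nue max]] := gram_max B0.
apply: le_trans (max v Pv) _; rewrite ler_wpM2r ?sqnorm_ge0//.
exact: lambda_max_eig nu0 bB nue.
Qed.

Lemma lambda_max_gt0 k n (B : 'M[R]_(k, n)) beta :
  (lambda_max (B *m B^T) <= beta%:E)%E -> B != 0 -> 0 < beta.
Proof.
move=> bB /gram_max[nu [nu0 nue _]]; apply: (lt_le_trans nu0).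
exact: lambda_max_eig nu0 bB nue.
Qed.

(** The vector z = B^+ w lies in the row space of [B], so alpha |z|^2 <=
|B z|^2; and B z = B B^+ w is an orthogonal projection of w. *)
Lemma sqnorm_mp_inverse k n (B : 'M[R]_(k, n)) alpha w :
  (alpha%:E <= lambda_minp (B *m B^T))%E ->
  alpha * sqnorm (mp_inverse B *m w) <= sqnorm w.
Proof.
move=> aB; have [_ _ Qs _] := mp_inverseP B.
apply: le_trans (_ : sqnorm (B *m mp_inverse B *m w) <= _).
  by rewrite -mulmxA; apply: lambda_minp_le => //; rewrite mulmxA row_proj_mp.
apply: sqnorm_proj_le => //; rewrite mulmxA; congr (_ *m _).
by have [] := mp_inverseP B.
Qed.

(** The square of [sigma_minp A] is the minimum of the Rayleigh quotient over
the row space: eigenvectors of [A^T A] for nonzero eigenvalues lie in that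
space, so no smaller nonzero singular value exists. *)
Lemma sigma_minpP m n (A : 'M[R]_(m, n)) : A != 0 ->
  0 < sigma_minp A /\
  forall v, row_proj A *m v = v ->
    sigma_minp A ^+ 2 * sqnorm v <= sqnorm (A *m v).
Proof.
move=> A0; have [mu [mu0 mue min]] := gram_min A0.
set S := [set s | singular_value A s /\ s != 0].
have Smu : S (Num.sqrt mu).
  split; first split; rewrite ?sqrtr_ge0 ?sqr_sqrtr ?ltW//.
  by rewrite gt_eqF// sqrtr_gt0.
have Slb : lbound S (Num.sqrt mu).
  move=> s [[s0 /eigenvalueP[v vE v0]] sn0].
  have s2 : s ^+ 2 != 0 by rewrite expf_neq0.
  have Pv : row_proj A *m v^T = v^T.
    apply: (scalerI s2); rewrite scalemxAr -linearZ /= -vE !trmx_mul trmxK.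
    by rewrite !mulmxA row_proj_tr.
  have := min _ Pv; rewrite -gram_sqnorm [A^T *m A](_ : _ = (A^T *m A)^T).
    rewrite -trmx_mul vE linearZ /= dotcZr.
    rewrite ler_pM2r ?sqnorm_gt0 ?trmx_eq0// => h.
    by rewrite -[leRHS]ger0_norm// -sqrtr_sqr ler_sqrt ?exprn_ge0.
  by rewrite trmx_mul trmxK.
have sE : sigma_minp A = Num.sqrt mu.
  apply/eqP; rewrite eq_le; apply/andP; split.
    by apply: ge_inf => //; exists (Num.sqrt mu).
  by apply: lb_le_inf => //; exists (Num.sqrt mu).
by rewrite sE sqrtr_gt0 sqr_sqrtr ?ltW.
Qed.

(** * Row coverings and one step of the iteration *)

Section Blocks.
Variables (m n : nat) (A : 'M[R]_(m, n)).

Lemma row_restrict_mul (tau : {set 'I_m}) p (y : 'M[R]_(n, p)) :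
  row_restrict tau (A *m y) = row_restrict tau A *m y.
Proof. by rewrite /row_restrict mul_rowsub_mx. Qed.

Lemma sqnorm_row_restrict (tau : {set 'I_m}) (v : 'cV[R]_m) :
  sqnorm (row_restrict tau v) = \sum_(i in tau) v i 0 ^+ 2.
Proof.
by rewrite sqnormE [RHS]big_enum_val; apply: eq_bigr => i _; rewrite mxE.
Qed.

(** The row space of a block is contained in that of [A]. *)
Lemma row_proj_restrict (tau : {set 'I_m}) :
  row_proj A *m row_proj (row_restrict tau A) = row_proj (row_restrict tau A).
Proof.
rewrite -[RHS]row_projT -(row_projT A) -(row_projT (row_restrict tau A)).
rewrite -trmx_mul {1}/row_proj -mulmxA -row_restrict_mul mulmx_row_proj.
by rewrite trmxK; exact: row_projT.
Qed.

Lemma row_proj_restrict_mp (tau : {set 'I_m}) :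
  row_proj A *m mp_inverse (row_restrict tau A) =
  mp_inverse (row_restrict tau A).
Proof.
by rewrite -(row_proj_mp (row_restrict tau A)) mulmxA row_proj_restrict.
Qed.

End Blocks.

Lemma multiplicityE m d (T : 'I_d -> {set 'I_m}) i :
  multiplicity T i = #|[pred l | i \in T l]|.
Proof.
apply: eq_card => l; rewrite !inE /=.
by apply/idP/idP => [/set_mem|/mem_set].
Qed.

Section Covering.
Variables (m n d : nat) (A : 'M[R]_(m, n)) (T : 'I_d -> {set 'I_m}).
Variables (alpha beta : R) (r rmax : nat).
Hypothesis covT : row_covering A T alpha beta r rmax.
Hypothesis A_neq0 : A != 0.

Let B l := row_restrict (T l) A.

Lemma multiplicity_ge i : (r <= multiplicity T i)%N.
Proof.
case: covT => _ _ _ -> _; have := mem_index_enum i.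
elim: (index_enum _) => //= j s IH; rewrite in_cons big_cons geq_min.
by case/orP => [/eqP <-|/IH ->]; rewrite ?leqnn ?orbT.
Qed.

Lemma multiplicity_le i : (multiplicity T i <= rmax)%N.
Proof. by case: covT => _ _ _ _ ->; exact: leq_bigmax. Qed.

Lemma nonzero_row : exists i, row i A != 0.
Proof.
apply/existsP; apply: contraNT A_neq0; rewrite negb_exists => /forallP A0.
by apply/eqP/row_matrixP => i; rewrite row0; apply/eqP/negPn/A0.
Qed.

Lemma nonzero_block : exists l, B l != 0.
Proof.
have [i Ai] := nonzero_row; have [cov _ _ _ _] := covT.
have [l il] := cov i; exists l; apply: contra Ai => /eqP Bl.
apply/eqP/rowP => j; rewrite !mxE -(enum_rankK_in il il).
by have /matrixP/(_ (enum_rank_in il i) j) := Bl; rewrite !mxE.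
Qed.

Lemma covering_d_gt0 : (0 < d)%N.
Proof. by have [[l ld] _] := nonzero_block; exact: leq_ltn_trans ld. Qed.

(** Positivity of beta is forced by a nonzero block, and there is one because
every row is covered. *)
Lemma covering_beta_gt0 : 0 < beta.
Proof.
by have [l] := nonzero_block; apply: lambda_max_gt0; have [_ _ + _ _] := covT.
Qed.

Lemma covering_r_gt0 : (0 < r)%N.
Proof.
have [cov _ _ -> _] := covT.
apply: (big_ind (fun k => 0 < k)%N); first exact: covering_d_gt0.
  by move=> x y x0 y0; rewrite leq_min x0.
move=> i _; have [l il] := cov i.
by rewrite multiplicityE; apply/card_gt0P; exists l.
Qed.

Lemma sum_sqnorm_row_restrict (v : 'cV[R]_m) :
  \sum_l sqnorm (row_restrict (T l) v) =
  \sum_i (multiplicity T i)%:R * v i 0 ^+ 2.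
Proof.
under eq_bigr do rewrite sqnorm_row_restrict big_mkcond /=.
rewrite exchange_big /=; apply: eq_bigr => i _.
by rewrite -big_mkcond /= sumr_const mulr_natl multiplicityE.
Qed.

Definition residual_proj l : 'M[R]_n := 1%:M - row_proj (B l).

(** By Pythagoras |(I - P_l) y|^2 = |y|^2 - |P_l y|^2, and
beta |P_l y|^2 >= |A_l y|^2. Summed over l, the last terms give at least
r |A y|^2 since each row of [A] occurs in at least r blocks. *)
Lemma sum_residual_le (y : 'cV[R]_n) : row_proj A *m y = y ->
  \sum_l sqnorm (residual_proj l *m y) <=
  (d%:R - r%:R * sigma_minp A ^+ 2 / beta) * sqnorm y.
Proof.
move=> Py; have b0 := covering_beta_gt0.
have h l : sqnorm (residual_proj l *m y) <=
    sqnorm y - sqnorm (row_restrict (T l) (A *m y)) / beta.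
  rewrite (@sqnorm_proj _ (row_proj (B l)) y) ?row_projT ?row_proj_idem//.
  rewrite -/(residual_proj l) addrAC lerDr subr_ge0 ler_pdivrMr// mulrC.
  rewrite row_restrict_mul -/(B l) -{1}(mulmx_row_proj (B l)) -mulmxA.
  apply: lambda_max_ge; last by rewrite mulmxA row_proj_idem.
  by have [_ _ + _ _] := covT.
apply: le_trans (ler_sum _ (fun l _ => h l)) _.
rewrite sumrB sumr_const card_ord -mulr_suml mulrBl.
rewrite -[sqnorm y *+ d]mulr_natl lerD2l lerN2.
rewrite mulrAC ler_pM2r ?invr_gt0// -mulrA sum_sqnorm_row_restrict.
have [_ /(_ _ Py) sA] := sigma_minpP A_neq0.
apply: le_trans (ler_wpM2l _ sA) _; first exact: ler0n.
rewrite sqnormE mulr_sumr; apply: ler_sum => i _.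
by rewrite ler_wpM2r ?sqr_ge0// ler_nat multiplicity_ge.
Qed.

Definition rate : R := 1 - r%:R * sigma_minp A ^+ 2 / (beta * d%:R).

Lemma rateE : rate = (d%:R - r%:R * sigma_minp A ^+ 2 / beta) / d%:R.
Proof.
have d0 : d%:R != 0 :> R by rewrite pnatr_eq0 -lt0n covering_d_gt0.
by rewrite /rate mulrBl divff// invfM mulrA.
Qed.

(** Some nonzero vector y lies in the row space of [A], and [sum_residual_le]
bounds a nonnegative sum by d rate |y|^2. Nonnegativity allows iterating the
recursion on the mean error. *)
Lemma rate_ge0 : 0 <= rate.
Proof.
have [u Pu u0] := row_proj_ex A_neq0.
rewrite rateE; apply: divr_ge0 => //.
have := sum_residual_le Pu => /(le_trans _) h.
rewrite -(pmulr_lge0 _ (_ : 0 < sqnorm u)) ?sqnorm_gt0//; apply: h.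
by apply: sumr_ge0 => l _; exact: sqnorm_ge0.
Qed.

Section Step.
Variables (b : 'cV[R]_m) (x0 : 'cV[R]_n).
Hypothesis b_range : exists y : 'cV[R]_n, b = A *m y.

Definition kaczmarz_limit : 'cV[R]_n :=
  (1%:M - mp_inverse A *m A) *m x0 + mp_inverse A *m b.

Lemma mul_kaczmarz_limit : A *m kaczmarz_limit = b.
Proof.
have APA : A *m mp_inverse A *m A = A by have [] := mp_inverseP A.
rewrite /kaczmarz_limit; have [y ->] := b_range.
rewrite mulmxDr (mulmxA A _ x0) mulmxBr mulmx1 (mulmxA A _ A) APA subrr mul0mx.
by rewrite add0r !mulmxA APA.
Qed.

Lemma kaczmarz_step (tau : {set 'I_m}) (x : 'cV[R]_n) (e : 'cV[R]_m) :
  x + mp_inverse (row_restrict tau A) *m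
    (row_restrict tau (b + e) - row_restrict tau A *m x) - kaczmarz_limit =
  (1%:M - row_proj (row_restrict tau A)) *m (x - kaczmarz_limit)
  + mp_inverse (row_restrict tau A) *m row_restrict tau e.
Proof.
have -> : row_restrict tau (b + e) =
    row_restrict tau A *m kaczmarz_limit + row_restrict tau e.
  rewrite -row_restrict_mul mul_kaczmarz_limit.
  by apply/matrixP => i j; rewrite !mxE.
rewrite mulmxBl mul1mx /row_proj -mulmxA !(mulmxDr, mulmxN).
move: (mp_inverse _ *m _) (mp_inverse _ *m _) (mp_inverse _ *m _) => u v w.
by apply/matrixP => i j; rewrite !mxE; ring.
Qed.

(** The cross term vanishes as (I - B^+ B) B^+ = 0. *)
Lemma sqnorm_kaczmarz_step (tau : {set 'I_m}) (y : 'cV[R]_n)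
    (w : 'cV[R]_(#|tau|)) :
  sqnorm ((1%:M - row_proj (row_restrict tau A)) *m y
       + mp_inverse (row_restrict tau A) *m w) =
  sqnorm ((1%:M - row_proj (row_restrict tau A)) *m y)
  + sqnorm (mp_inverse (row_restrict tau A) *m w).
Proof.
rewrite sqnormD dotc_trmx linearB /= trmx1 row_projT.
rewrite mulmxA [X in dotc y (X *m w)](_ : _ = 0).
  by rewrite mul0mx dotc0r mulr0 addr0.
by rewrite mulmxBl mul1mx row_proj_mp subrr.
Qed.

Variables (tau : nat -> {set 'I_m}) (e : nat -> 'cV[R]_m).

(** The initial error is A^+ (A x0 - b), and corrections lie in the row spaces
of blocks. *)
Lemma row_proj_error k :
  let y := block_kaczmarz A x0 tau (fun i => b + e i) k - kaczmarz_limit in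
  row_proj A *m y = y.
Proof.
elim: k => [|k IH] /=.
  have -> : x0 - kaczmarz_limit = row_proj A *m x0 - mp_inverse A *m b.
    rewrite /kaczmarz_limit mulmxBl mul1mx /row_proj.
    by apply/matrixP => i j; rewrite !mxE; ring.
  by rewrite mulmxBr mulmxA row_proj_idem mulmxA row_proj_mp.
rewrite kaczmarz_step; move: (_ - kaczmarz_limit) IH => y Py.
rewrite mulmxBl mul1mx mulmxDr mulmxBr Py.
rewrite (mulmxA _ (row_proj _)) row_proj_restrict.
by rewrite (mulmxA _ (mp_inverse _)) row_proj_restrict_mp.
Qed.

End Step.

Lemma noise_le (alpha0 : 0 < alpha) l (e : 'cV[R]_m) :
  sqnorm (mp_inverse (B l) *m row_restrict (T l) e) <=
  alpha^-1 * sqnorm (row_restrict (T l) e).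
Proof.
rewrite -ler_pdivrMl ?invr_gt0// invrK; apply: sqnorm_mp_inverse.
by have [_ + _ _ _] := covT.
Qed.

Lemma sum_noise_le (alpha0 : 0 < alpha) (s : 'I_m -> R) :
  (forall i, 0 <= s i) ->
  \sum_l alpha^-1 * (\sum_(i in T l) s i) <= rmax%:R / alpha * \sum_i s i.
Proof.
move=> s0; rewrite -mulr_sumr mulrAC [leRHS]mulrC ler_pM2l ?invr_gt0//.
under eq_bigr do rewrite big_mkcond /=.
rewrite exchange_big /= mulr_sumr; apply: ler_sum => i _.
rewrite -big_mkcond /= sumr_const -[s i *+ _]mulr_natl ler_wpM2r// ler_nat.
by have := multiplicity_le i; rewrite multiplicityE.
Qed.

End Covering.

End LinearAlgebra.

(** * Integrals over an independent event *)

Section RestrictedIntegrals.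
Context d (Omega : measurableType d) (R : realType).

Lemma ge0_integral_mrestr (mu : {measure set Omega -> \bar R}) (H : set Omega)
    (mH : measurable H) (f : Omega -> \bar R) :
  measurable_fun setT f -> (forall x, (0 <= f x)%E) ->
  (\int[mrestr mu mH]_x f x = \int[mu]_(x in H) f x)%E.
Proof.
move=> mf f0; rewrite -(setUv H) ge0_integral_setU//; last 3 first.
- exact: measurableC.
- by rewrite setUv.
- by apply/disj_setPCl.
rewrite [X in (_ + X)%E]null_set_integral ?adde0//; last 3 first.
- exact: measurableC.
- exact: measurable_funTS.
- by rewrite /= /mrestr setICl measure0.
apply: eq_measure_integral => E mE EH /=.
by rewrite /mrestr setIidl.
Qed.

(** By uniqueness of measures on a pi-system, P restricted to [H] and P scaled
by the constant P H agree on the sigma-algebra generated by [G]; an integral of a function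
measurable for that sigma-algebra only sees these values, which the image
measures under the identity make formal. *)
Lemma integral_indep_event (P : probability Omega R) (G : set (set Omega))
    (H : set Omega) (f : Omega -> \bar R) :
  G `<=` measurable -> setI_closed G -> G setT -> measurable H ->
  (forall E, G E -> P (E `&` H) = (P H * P E)%E) ->
  measurable_fun [set: g_sigma_algebraType G] f ->
  (forall x, (0 <= f x)%E) ->
  (\int[P]_(x in H) f x = P H * \int[P]_x f x)%E.
Proof.
move=> Gm GI GT mH indep mf f0.
have sGm : <<s G >> `<=` @measurable _ Omega.
  by apply: smallest_sub => //; exact: sigma_algebra_measurable.
pose G' := g_sigma_algebraType G.
have mid : measurable_fun [set: Omega] (id : Omega -> G').
  by move=> _ B mB; rewrite setTI; exact: sGm.
have mf' : measurable_fun [set: Omega] f.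
  move=> _ B mB; rewrite setTI; apply: sGm.
  by have := mf measurableT B mB; rewrite setTI.
have p0 : 0 <= fine (P H) by rewrite fine_ge0.
have PH : (fine (P H))%:E = P H by rewrite fineK// fin_num_measure.
pose p := NngNum p0.
pose m1 : {measure set Omega -> \bar R} := mrestr P mH.
pose m2 : {measure set Omega -> \bar R} := mscale p P.
have m12 E : <<s G >> E -> m1 E = m2 E.
  apply: (@g_sigma_algebra_measure_unique _ R Omega G Gm (fun=> setT)) => //.
  - by rewrite bigcup_const.
  - by move=> A GA; rewrite /m1 /m2 /= /mrestr /mscale /= PH indep.
  - move=> _; rewrite /m1 /= /mrestr setTI.
    exact: (le_lt_trans (probability_le1 P mH)) (ltry _).
rewrite -ge0_integral_mrestr// -/m1.
have := @ge0_integral_pushforward _ _ Omega G' R id mid m1 setT f measurableT mf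
  (fun x _ => f0 x).
rewrite preimage_setT => <-.
rewrite (@eq_measure_integral _ _ _ _ (pushforward m2 (id : Omega -> G')))//.
  rewrite ge0_integral_pushforward//.
  by rewrite preimage_setT /m2 ge0_integral_mscale//= PH.
by move=> E mE _; exact: m12.
Qed.

End RestrictedIntegrals.

Section OtherEvents.
Context d (Omega : measurableType d) (R : realType) (P : probability Omega R).
Variables (I : eqType) (F : I -> set (set Omega)) (i0 : I).

(** A pi-system that generates the sigma-algebra of all the variables except the
one with index [i0]. Requiring [K j] in [F j] for every index, also outside [J],
lets two such events be intersected index by index. *)
Definition other_events : set (set Omega) :=
  [set E | exists J : seq I, exists K : I -> set Omega,
    [/\ uniq J, i0 \notin J, forall j, F j (K j) &
        E = \bigcap_(j in [set` J]) K j]].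

Hypothesis FT : forall j, F j setT.

Lemma other_eventsT : other_events setT.
Proof.
exists [::], (fun=> setT); split => //.
by apply/seteqP; split.
Qed.

Lemma other_events_sub j : j != i0 -> F j `<=` other_events.
Proof.
move=> ji E FE; exists [:: j], (fun i => if i == j then E else setT).
split => //.
- by rewrite mem_seq1 eq_sym.
- by move=> i; case: eqP => [->|].
- apply/seteqP; split => [w Ew i /=|w /(_ j)]; rewrite /= ?mem_seq1 ?eqxx.
    by move=> ->.
  exact.
Qed.

Lemma other_events_setI : (forall j, setI_closed (F j)) ->
  setI_closed other_events.
Proof.
move=> FI _ _ [J [K [uJ iJ FK ->]]] [J' [K' [uJ' iJ' FK' ->]]].
exists (undup (J ++ J')), (fun j => (if j \in J then K j else setT) `&`
                                    (if j \in J' then K' j else setT)).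
split; first exact: undup_uniq.
- by rewrite mem_undup mem_cat negb_or iJ.
- by move=> j; apply: FI; case: ifP.
- apply/seteqP; split => [w [KJ KJ'] j _ /=|w KK].
    by split; case: ifP => // jJ; [exact: KJ | exact: KJ'].
  by split => j /= jJ; have := KK j; rewrite /= mem_undup mem_cat jJ ?orbT;
    case=> //.
Qed.

Lemma other_events_measurable : (forall j, F j `<=` measurable) ->
  other_events `<=` measurable.
Proof.
move=> Fm _ [J [K [_ _ FK ->]]].
by apply: fin_bigcap_measurable => // j _; exact/Fm/FK.
Qed.

Lemma other_events_indep (H E : set Omega) : independent_systems P F ->
  F i0 H -> other_events E -> P (E `&` H) = (P H * P E)%E.
Proof.
move=> indep FH [J [K [uJ iJ FK ->]]].
pose K' i := if i == i0 then H else K i.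
have K'E j : j \in J -> K' j = K j.
  by rewrite /K'; case: eqP => // -> h; rewrite h in iJ.
rewrite (indep J K uJ)//.
have -> : \bigcap_(j in [set` J]) K j `&` H =
    \bigcap_(j in [set` i0 :: J]) K' j.
  apply/seteqP; split => [w [KJ Hw] j /=|w KK].
    rewrite in_cons => /orP[/eqP ->|jJ]; first by rewrite /K' eqxx.
    by rewrite K'E//; exact: KJ.
  split => [j /= jJ|].
    by rewrite -K'E//; apply: KK; rewrite /= in_cons jJ orbT.
  by have := KK i0; rewrite /= in_cons eqxx /K' eqxx; exact.
rewrite indep /= ?iJ//.
  rewrite big_cons {1}/K' eqxx; congr (_ * _)%E.
  by rewrite !big_seq; apply: eq_bigr => j /K'E ->.
by move=> j _; rewrite /K'; case: eqP => // ->.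
Qed.

End OtherEvents.

(** * Measurability of the iterates *)

Section CoordinateMeasurability.
Context d (Omega : measurableType d) (R : realType).

(** Measurability coordinate by coordinate. The underlying space is arbitrary,
so that the iterates can be handled both for the full sigma-algebra and for the
one generated by part of the variables. *)
Definition measurable_cV n (X : Omega -> 'cV[R]_n) :=
  forall i, measurable_fun setT (fun w => X w i 0).

Lemma measurable_cV_cst n (v : 'cV[R]_n) : measurable_cV (fun=> v).
Proof. by move=> i; exact: measurable_cst. Qed.

Lemma measurable_cVD n (X Y : Omega -> 'cV[R]_n) :
  measurable_cV X -> measurable_cV Y -> measurable_cV (fun w => X w + Y w).
Proof.
move=> mX mY i.
rewrite (_ : (fun _ => _) = (fun w => X w i 0) \+ (fun w => Y w i 0)).
  exact: measurable_funD.
by apply/funext => w; rewrite !mxE.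
Qed.

Lemma measurable_cVM k n (M : 'M[R]_(k, n)) (X : Omega -> 'cV[R]_n) :
  measurable_cV X -> measurable_cV (fun w => M *m X w).
Proof.
move=> mX i; rewrite (_ : (fun _ => _) = (fun w => \sum_j M i j * X w j 0)).
  by apply: measurable_sum => j; apply: measurable_funM.
by apply/funext => w; rewrite !mxE.
Qed.

Lemma measurable_cVB n (X Y : Omega -> 'cV[R]_n) :
  measurable_cV X -> measurable_cV Y -> measurable_cV (fun w => X w - Y w).
Proof.
move=> mX mY i.
rewrite (_ : (fun _ => _) = (fun w => X w i 0) \- (fun w => Y w i 0)).
  exact: measurable_funB.
by apply/funext => w; rewrite !mxE.
Qed.

Lemma measurable_cV_restrict m (tau : {set 'I_m}) (X : Omega -> 'cV[R]_m) :
  measurable_cV X -> measurable_cV (fun w => row_restrict tau (X w)).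
Proof.
move=> mX i; rewrite (_ : (fun _ => _) = (fun w => X w (enum_val i) 0)) //.
by apply/funext => w; rewrite mxE.
Qed.

Lemma measurable_sqnorm n (X : Omega -> 'cV[R]_n) :
  measurable_cV X -> measurable_fun setT (fun w => sqnorm (X w)).
Proof.
move=> mX; rewrite (_ : (fun _ => _) = (fun w => \sum_i X w i 0 * X w i 0)).
  by apply: measurable_sum => i; apply: measurable_funM.
by apply/funext => w; rewrite /sqnorm dotcE.
Qed.

Lemma sum_choice k (c : 'I_k) (f : 'I_k -> R) :
  f c = \sum_l f l * (c == l)%:R.
Proof.
rewrite (bigD1 c) //= eqxx mulr1 big1 ?addr0// => l lc.
by rewrite eq_sym (negPf lc) mulr0.
Qed.

Lemma measurable_choice k (c : Omega -> 'I_k) l :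
  measurable (c @^-1` [set l]) ->
  measurable_fun setT (fun w => (c w == l)%:R : R).
Proof.
move=> mc; rewrite (_ : (fun _ => _) = \1_(c @^-1` [set l])).
  exact: measurable_indic.
apply/funext => w; rewrite indicE; congr (_%:R); congr nat_of_bool.
by apply/eqP/idP => [cl|/set_mem]; first exact: mem_set.
Qed.

Lemma measurable_cV_choice k n (c : Omega -> 'I_k)
    (X : 'I_k -> Omega -> 'cV[R]_n) :
  (forall l, measurable (c @^-1` [set l])) ->
  (forall l, measurable_cV (X l)) -> measurable_cV (fun w => X (c w) w).
Proof.
move=> mc mX i.
rewrite (_ : (fun _ => _) = (fun w => \sum_l X l w i 0 * (c w == l)%:R)).
  apply: measurable_sum => l; apply: measurable_funM; first exact: mX.
  exact: measurable_choice.
by apply/funext => w; rewrite -(sum_choice (c w) (fun l => X l w i 0)).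
Qed.

(** Only the first [K] choices and right-hand sides matter; this is what
separates the K-th iterate from the K-th choice. *)
Lemma measurable_block_kaczmarz m n k (A : 'M[R]_(m, n)) (x0 : 'cV[R]_n)
    (T : 'I_k -> {set 'I_m}) (c : nat -> Omega -> 'I_k)
    (b : nat -> Omega -> 'cV[R]_m) (K : nat) :
  (forall i l, (i < K)%N -> measurable (c i @^-1` [set l])) ->
  (forall i, (i < K)%N -> measurable_cV (b i)) ->
  measurable_cV (fun w =>
    block_kaczmarz A x0 (fun i => T (c i w)) (fun i => b i w) K).
Proof.
elim: K => [|K IH] mc mb /=; first exact: measurable_cV_cst.
pose x w := block_kaczmarz A x0 (fun i => T (c i w)) (fun i => b i w) K.
have mx : measurable_cV x.
  by apply: IH => [i l|i] iK; [apply: mc | apply: mb]; exact: ltnW.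
apply: (@measurable_cV_choice _ _ (c K) (fun l w => x w +
  mp_inverse (row_restrict (T l) A) *m
    (row_restrict (T l) (b K w) - row_restrict (T l) A *m x w))) => [l|l].
  exact: mc.
apply: measurable_cVD => //; apply: measurable_cVM; apply: measurable_cVB.
  by apply: measurable_cV_restrict; exact: mb.
exact: measurable_cVM.
Qed.

End CoordinateMeasurability.

Lemma measurable_coord (R : realType) m i :
  measurable_fun [set: borel_cV R m]
    (fun v : borel_cV R m => (v : 'cV[R]_m) i 0).
Proof.
apply: (@measurability _ _ (borel_cV R m) (measurableTypeR R) setT _ _
  (RGenOpens.measurableE R)) => _ [_ [x [y ->]] <-].
rewrite setTI; apply: sub_sigma_algebra.
apply: (@open_comp 'cV[R]_m R (fun v => v i 0)) => [v _|].
  exact: coord_continuous.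
exact: interval_open.
Qed.

(** * The mean squared error *)

Lemma integral_choice d (Omega : measurableType d) (R : realType)
    (P : probability Omega R) k (c : Omega -> 'I_k) (f : 'I_k -> Omega -> R) :
  (forall l, measurable (c @^-1` [set l])) ->
  (forall l, measurable_fun setT (f l)) -> (forall l w, 0 <= f l w) ->
  (\int[P]_w (f (c w) w)%:E =
   \sum_l \int[P]_(w in c @^-1` [set l]) (f l w)%:E)%E.
Proof.
move=> mc mf f0.
have -> : (fun w => (f (c w) w)%:E) =
    (fun w => \sum_l (((fun w => (f l w)%:E) \_ (c @^-1` [set l])) w))%E.
  apply/funext => w; rewrite (bigD1 (c w)) //= patchE mem_set//.
  rewrite big1 ?adde0// => l lc; rewrite patchE memNset// => cw.
  by move: lc; rewrite cw eqxx.
rewrite ge0_integral_sum//.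
- by apply: eq_bigr => l _; rewrite [RHS]integral_mkcond.
- move=> l; apply/(measurable_restrictT _ _).1 => //.
  by apply: measurable_funTS; exact/measurable_EFinP.
- by move=> l w _; rewrite patchE; case: ifP => // _; rewrite lee_fin.
Qed.

Section Convergence.
Context (R : realType) (m n d : nat) (A : 'M[R]_(m, n)) (b : 'cV[R]_m)
  (x0 : 'cV[R]_n) (T : 'I_d -> {set 'I_m}) (alpha beta : R) (r rmax : nat)
  (disp : measure_display) (Omega : measurableType disp)
  (P : probability Omega R) (c : nat -> Omega -> 'I_d)
  (e : nat -> {RV P >-> borel_cV R m})
  (D : probability (borel_cV R m) R) (Sigma : 'M[R]_m).
Hypotheses (A_neq0 : A != 0)
  (b_range : exists y : 'cV[R]_n, b = A *m y)
  (covT : row_covering A T alpha beta r rmax)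
  (alpha_gt0 : 0 < alpha)
  (c_meas : forall k l, measurable (c k @^-1` [set l]))
  (c_unif : forall k l, P (c k @^-1` [set l]) = (d%:R^-1)%:E)
  (e_distr : forall k (B : set (borel_cV R m)),
     measurable B -> distribution P (e k) B = D B)
  (ce_indep : independent_systems P (choice_error_sigma c e))
  (D_cov : forall i j : 'I_m,
     'E_D[fun v : 'cV[R]_m => ((v *m v^T) i j)%R]%E = (Sigma i j)%:E).

Let xstar := kaczmarz_limit A b x0.
Let x k w := block_kaczmarz A x0 (fun i => T (c i w)) (fun i => b + e i w) k.
Let F := choice_error_sigma c e.

Lemma second_moment k i :
  (\int[P]_w (((e k w : 'cV[R]_m) i 0) ^+ 2)%:E = (Sigma i i)%:E)%E.
Proof.
have mi : measurable_fun [set: borel_cV R m]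
    (fun v : borel_cV R m => (((v : 'cV[R]_m) i 0) ^+ 2)%:E).
  by apply/measurable_EFinP/measurable_funX; exact: measurable_coord.
rewrite -D_cov unlock.
rewrite -(@ge0_integral_distribution _ _ _ _ _ P (e k)
  (fun v : borel_cV R m => (((v : 'cV[R]_m) i 0) ^+ 2)%:E))//; last first.
  by move=> v; rewrite lee_fin sqr_ge0.
rewrite (eq_measure_integral D) => [|B mB _]; last exact: e_distr.
by apply: eq_integral => v _; rewrite mxE big_ord1 !mxE.
Qed.

Lemma trace_cov_ge0 : 0 <= \tr Sigma.
Proof.
apply: sumr_ge0 => i _; rewrite -lee_fin -(second_moment 0 i).
by apply: integral_ge0 => w _; rewrite lee_fin sqr_ge0.
Qed.

Lemma error_cV_measurable k : measurable_cV (e k : Omega -> 'cV[R]_m).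
Proof.
move=> i; apply: (measurableT_comp (@measurable_coord R m i)).
exact: measurable_funPT.
Qed.

Lemma mean_error_sqnorm k :
  (\int[P]_w (sqnorm (e k w : 'cV[R]_m))%:E = (\tr Sigma)%:E)%E.
Proof.
under eq_integral do rewrite sqnormE -sumEFin.
rewrite ge0_integral_sum//.
- by rewrite -sumEFin; apply: eq_bigr => i _; exact: second_moment.
- move=> i; apply/measurable_EFinP/measurable_funX.
  exact: error_cV_measurable.
- by move=> i w _; rewrite lee_fin sqr_ge0.
Qed.

Lemma iterate_measurable k : measurable_cV (x k).
Proof.
apply: measurable_block_kaczmarz => [i l _|i _]; first exact: c_meas.
apply: measurable_cVD; first exact: measurable_cV_cst.
exact: error_cV_measurable.
Qed.

Lemma choice_error_sigmaT j : F j setT.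
Proof.
by case: j => k; exists setT; rewrite ?preimage_setT ?setTI//=.
Qed.

Lemma choice_error_sigmaI j : setI_closed (F j).
Proof.
case: j => k _ _ [B mB <-] [B' mB' <-]; exists (B `&` B');
  rewrite ?preimage_setI ?setTI//=.
exact: measurableI.
Qed.

Lemma choice_error_sigma_measurable j : F j `<=` measurable.
Proof.
case: j => k _ [B mB <-]; rewrite setTI.
  have -> : c k @^-1` B = \bigcup_(l in B) (c k @^-1` [set l]).
    apply/seteqP; split => [w Bw|w [l Bl /= cl]]; first by exists (c k w).
    by rewrite /= cl.
  by apply: fin_bigcup_measurable => // l _; exact: c_meas.
by rewrite -[X in measurable X]setTI; exact: measurable_funPT.
Qed.

Let G k := other_events F (inl k).

Lemma past_choice_measurable k i l : i != k ->
  measurable (c i @^-1` [set l] : set (g_sigma_algebraType (G k))).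
Proof.
move=> ik; apply: sub_sigma_algebra; apply: (other_events_sub _ (j := inl i)).
- exact: choice_error_sigmaT.
- by apply: contra ik => /eqP[->].
- by exists [set l] => //; rewrite setTI.
Qed.

Lemma error_measurable k i :
  measurable_cV (e i : g_sigma_algebraType (G k) -> 'cV[R]_m).
Proof.
move=> j _ B mB; rewrite setTI; apply: sub_sigma_algebra.
apply: (other_events_sub _ (j := inr i)) => //.
  exact: choice_error_sigmaT.
exists ((fun v : borel_cV R m => (v : 'cV[R]_m) j 0) @^-1` B).
  by rewrite -[X in measurable X]setTI; exact: measurable_coord.
by rewrite setTI.
Qed.

Lemma past_iterate_measurable k :
  measurable_cV (x k : g_sigma_algebraType (G k) -> 'cV[R]_n).
Proof.
apply: (@measurable_block_kaczmarz _ (g_sigma_algebraType (G k)))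
  => [i l ik|i _].
  by apply: past_choice_measurable; rewrite ltn_eqF.
apply: measurable_cVD; [exact: measurable_cV_cst | exact: error_measurable].
Qed.

(** The squared error after step k if the k-th choice is the block l. *)
Let gap k l w := sqnorm (residual_proj A T l *m (x k w - xstar)) +
  sqnorm (mp_inverse (row_restrict (T l) A) *m row_restrict (T l) (e k w)).

Lemma gap_ge0 k l w : 0 <= gap k l w.
Proof. by apply: addr_ge0; exact: sqnorm_ge0. Qed.

Lemma integral_gap k l :
  (\int[P]_(w in c k @^-1` [set l]) (gap k l w)%:E =
   (d%:R^-1)%:E * \int[P]_w (gap k l w)%:E)%E.
Proof.
rewrite -(c_unif k l); apply: (@integral_indep_event _ _ _ P (G k)).
- by apply: other_events_measurable; exact: choice_error_sigma_measurable.
- apply: other_events_setI; first exact: choice_error_sigmaT.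
  exact: choice_error_sigmaI.
- by apply: other_eventsT; exact: choice_error_sigmaT.
- exact: c_meas.
- move=> E; apply: (other_events_indep ce_indep).
  by exists [set l] => //; rewrite setTI.
- apply/measurable_EFinP; apply: measurable_funD; apply: measurable_sqnorm;
    apply: measurable_cVM.
    apply: measurable_cVB; first exact: past_iterate_measurable.
    exact: measurable_cV_cst.
  by apply: measurable_cV_restrict; exact: error_measurable.
- by move=> w; rewrite lee_fin gap_ge0.
Qed.

Lemma sqnorm_step k w : sqnorm (x k.+1 w - xstar) = gap k (c k w) w.
Proof.
rewrite /x /= -/(x k w) kaczmarz_step// sqnorm_kaczmarz_step.
by [].
Qed.

Lemma sum_gap_le k w : \sum_l gap k l w <=
  d%:R * rate d A beta r * sqnorm (x k w - xstar)
  + rmax%:R / alpha * sqnorm (e k w : 'cV[R]_m).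
Proof.
rewrite big_split /=; apply: lerD.
  have -> : d%:R * rate d A beta r = d%:R - r%:R * sigma_minp A ^+ 2 / beta.
    rewrite (rateE covT A_neq0) mulrC divfK// pnatr_eq0 -lt0n.
    exact: covering_d_gt0 covT A_neq0.
  apply: (sum_residual_le covT A_neq0).
  by apply: (row_proj_error x0 b_range (fun i => T (c i w)) (fun i => e i w)).
rewrite sqnormE; apply: le_trans (sum_noise_le covT alpha_gt0 _); last first.
  by move=> i; exact: sqr_ge0.
apply: ler_sum => l _; rewrite -sqnorm_row_restrict.
exact: noise_le covT alpha_gt0 _ _.
Qed.

(** Splitting according to the value of the k-th choice, each block contributes
with weight 1 / d by independence, and [sum_gap_le] bounds the sum. *)
Lemma mean_step k :
  (\int[P]_w (sqnorm (x k.+1 w - xstar))%:E <=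
   (rate d A beta r)%:E * \int[P]_w (sqnorm (x k w - xstar))%:E
   + (rmax%:R / (alpha * d%:R) * \tr Sigma)%:E)%E.
Proof.
have d0 : (0 < d%:R :> R) by rewrite ltr0n; exact: covering_d_gt0 covT A_neq0.
have mgap l : measurable_fun setT (gap k l).
  apply: measurable_funD; apply: measurable_sqnorm; apply: measurable_cVM.
    apply: measurable_cVB; first exact: iterate_measurable.
    exact: measurable_cV_cst.
  by apply: measurable_cV_restrict; exact: error_cV_measurable.
have msq : measurable_fun setT (fun w => sqnorm (x k w - xstar)).
  apply: measurable_sqnorm; apply: measurable_cVB.
    exact: iterate_measurable.
  exact: measurable_cV_cst.
have me : measurable_fun setT (fun w => sqnorm (e k w : 'cV[R]_m)).
  by apply: measurable_sqnorm; exact: error_cV_measurable.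
have rate0 := rate_ge0 covT A_neq0.
under eq_integral do rewrite sqnorm_step.
rewrite (@integral_choice _ _ _ P _ (c k) (gap k))//; last exact: gap_ge0.
under eq_bigr do rewrite integral_gap.
rewrite -ge0_sume_distrr; last first.
  by move=> l _; apply: integral_ge0 => w _; rewrite lee_fin gap_ge0.
rewrite -ge0_integral_sum//; last 2 first.
- by move=> l; exact/measurable_EFinP.
- by move=> l w _; rewrite lee_fin gap_ge0.
pose h w := (d%:R * rate d A beta r * sqnorm (x k w - xstar))%:E.
pose g w := (rmax%:R / alpha * sqnorm (e k w : 'cV[R]_m))%:E.
apply: (@le_trans _ _ ((d%:R^-1)%:E * \int[P]_w (h w + g w))%E).
  apply: lee_wpmul2l; first by rewrite lee_fin invr_ge0 ltW.
  apply: ge0_le_integral => //.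
  - move=> w _; rewrite sumEFin lee_fin.
    by apply: sumr_ge0 => l _; exact: gap_ge0.
  - by apply: emeasurable_sum => l; exact/measurable_EFinP.
  - by apply/measurable_EFinP; apply: measurable_funD; apply: measurable_funM.
  - by move=> w _; rewrite sumEFin lee_fin sum_gap_le.
have c0 : 0 <= rmax%:R / alpha :> R by rewrite divr_ge0 ?ler0n ?ltW.
rewrite ge0_integralD//; last 4 first.
- by move=> w _; rewrite lee_fin mulr_ge0 ?sqnorm_ge0// mulr_ge0// ltW.
- by apply/measurable_EFinP; apply: measurable_funM.
- by move=> w _; rewrite lee_fin mulr_ge0 ?sqnorm_ge0.
- by apply/measurable_EFinP; apply: measurable_funM.
rewrite /h /g; under eq_integral do rewrite EFinM.
rewrite ge0_integralZl//; last 3 first.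
- exact/measurable_EFinP.
- by move=> w _; rewrite lee_fin sqnorm_ge0.
- by rewrite lee_fin mulr_ge0 ?ler0n.
under [X in (_ + X)%E]eq_integral do rewrite EFinM.
rewrite ge0_integralZl//; last 2 first.
- exact/measurable_EFinP.
- by move=> w _; rewrite lee_fin sqnorm_ge0.
rewrite mean_error_sqnorm ge0_muleDr; last 2 first.
- apply: mule_ge0; first by rewrite lee_fin mulr_ge0 ?ler0n.
  by apply: integral_ge0 => w _; rewrite lee_fin sqnorm_ge0.
- by rewrite -EFinM lee_fin mulr_ge0 ?trace_cov_ge0.
rewrite muleA -!EFinM mulrA mulVf ?mul1r ?gt_eqF// mulrA.
by rewrite [in leRHS]invfM (mulrC d%:R^-1) mulrA.
Qed.

(** The fixed point of the recursion of [mean_step]. *)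
Let limit_error :=
  beta * rmax%:R / (alpha * r%:R * sigma_minp A ^+ 2) * \tr Sigma.

Lemma mean_error_le k :
  (\int[P]_w (sqnorm (x k w - xstar))%:E <=
   (rate d A beta r ^+ k * sqnorm (x0 - xstar) + limit_error)%:E)%E.
Proof.
have beta0 := covering_beta_gt0 covT A_neq0.
have r0 : 0 < r%:R :> R by rewrite ltr0n; exact: covering_r_gt0 covT A_neq0.
have d0 : (0 < d%:R :> R) by rewrite ltr0n; exact: covering_d_gt0 covT A_neq0.
have [sigma0 _] := sigma_minpP A_neq0.
have err0 : 0 <= limit_error.
  have alpha_ge0 := ltW alpha_gt0; have beta_ge0 := ltW beta0.
  have sigma_ge0 := ltW sigma0.
  by rewrite mulr_ge0 ?trace_cov_ge0// divr_ge0// !mulr_ge0.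
elim: k => [|k IH].
  have -> : (\int[P]_w (sqnorm (x 0 w - xstar))%:E =
      (sqnorm (x0 - xstar))%:E)%E.
    rewrite -[LHS]/(\int[P]_(w in setT) cst (sqnorm (x0 - xstar))%:E w)%E.
    rewrite integral_cst// -[RHS]mule1; congr (_ * _)%E.
    exact: probability_setT.
  by rewrite lee_fin mul1r lerDl.
apply: le_trans (mean_step k) _.
apply: le_trans (leeD2r _ (lee_wpmul2l _ IH)) _.
  by rewrite lee_fin (rate_ge0 covT).
rewrite -EFinM -EFinD lee_fin mulrDr mulrA -exprS -addrA lerD2l.
rewrite le_eqVlt; apply/orP; left; apply/eqP.
rewrite /limit_error /rate; field.
by rewrite !gt_eqF.
Qed.

End Convergence.

Theorem proposition4p2 (R : realType) (m n d : nat)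
  (A : 'M[R]_(m, n)) (b : 'cV[R]_m) (x0 : 'cV[R]_n)
  (T : 'I_d -> {set 'I_m}) (alpha beta : R) (r rmax : nat)
  (disp : measure_display) (Omega : measurableType disp)
  (P : probability Omega R)
  (c : nat -> Omega -> 'I_d)
  (e : nat -> {RV P >-> borel_cV R m})
  (D : probability (borel_cV R m) R) (Sigma : 'M[R]_m)
  (A_neq0 : A != 0)
  (b_range : exists y : 'cV[R]_n, b = A *m y)
  (covT : row_covering A T alpha beta r rmax)
  (alpha_gt0 : 0 < alpha)
  (c_meas : forall k l, measurable (c k @^-1` [set l]))
  (c_unif : forall k l, P (c k @^-1` [set l]) = (d%:R^-1)%:E)
  (e_distr : forall k (B : set (borel_cV R m)),
     measurable B -> distribution P (e k) B = D B)
  (ce_indep : independent_systems P (choice_error_sigma c e))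
  (D_mean : forall i : 'I_m, 'E_D[fun v : 'cV[R]_m => (v i 0)%R]%E = 0%E)
  (D_cov : forall i j : 'I_m,
     'E_D[fun v : 'cV[R]_m => ((v *m v^T) i j)%R]%E = (Sigma i j)%:E) :
  let xstar := (1%:M - mp_inverse A *m A) *m x0 + mp_inverse A *m b in
  let x k w := block_kaczmarz A x0 (fun i => T (c i w))
                              (fun i => b + e i w) k in
  forall j : nat,
    ('E_P[fun w => (norm2 (x j.+1 w - xstar) ^+ 2)%R] <=
     ((1 - r%:R * sigma_minp A ^+ 2 / (beta * d%:R)) ^+ j.+1
        * norm2 (x0 - xstar) ^+ 2
      + beta * rmax%:R / (alpha * r%:R * sigma_minp A ^+ 2)
        * \tr Sigma)%:E)%E.
Proof.
move=> xstar x j; rewrite unlock norm2_sqr.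
under eq_integral do rewrite norm2_sqr.
exact: (mean_error_le x0 A_neq0 b_range covT alpha_gt0 c_meas c_unif e_distr
  ce_indep D_cov j.+1).
Qed.
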